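(* The cycle index of the $3$-group $S_6^{(3)}$ of the symmetric group $S_6$, i.e. of the action of $S_6$ on the $20$ three-element subsets of $\{1,\dots,6\}$, in the variables $a_1,a_2,\dots$, is \begin{align*} Z(S_6^{(3)}) = \frac{1}{6!} \big(& a_{1}^{20} + 15 a_{1}^{8} a_{2}^{6} + 45 a_{1}^{4} a_{2}^{8} + 80 a_{1}^{2} a_{3}^{6} + 120 a_{1}^{2} a_{3}^{2} a_{6}^{2} + 15 a_{2}^{10} \\ & + 180 a_{2}^{2} a_{4}^{4} + 120 a_{2} a_{6}^{3} + 144 a_{5}^{4}\big). \end{align*}
   Context: For a permutation group $A$ on a finite set, and $\alpha\in A$, let $j_k(\alpha)$ be the number of cycles of length $k$ in the disjoint cycle decomposition of $\alpha$ (fixed points counted as cycles of length $1$). The cycle index of $A$ is the polynomial $Z(A)=\frac{1}{|A|}\sum_{\alpha\in A}\prod_{k} a_k^{j_k(\alpha)}$ in the variables $a_1,a_2,\dots$ with rational coefficients. For $1\le r\le p$, $S_p^{(r)}$ (the $r$-group of $S_p$) is the permutation group on the set of $r$-element subsets of $\{1,\dots,p\}$ formed by the permutations $\alpha'$ induced by $\alpha\in S_p$ via $\alpha'\{i_1,\dots,i_r\}=\{\alpha i_1,\dots,\alpha i_r\}$. *)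

(* Defs.v *)
From HB Require Import structures.
From mathcomp Require Import all_boot all_order all_algebra all_fingroup.
From mathcomp.multinomials Require Import monalg.

Set Implicit Arguments.
Unset Strict Implicit.
Unset Printing Implicit Defensive.

Import GRing.Theory.
Local Open Scope ring_scope.

(* Rational polynomials in countably many commuting variables: {cmonom nat} is
   the monoid of finitely supported exponent functions nat -> nat. Only the
   variables a_k with k >= 1 are used below. *)
Definition cpoly := {malg rat[{cmonom nat}]}.

Definition cvar (k : nat) : cpoly := << ucm k >>.

Notation "''a_' k" := (cvar k) (at level 8, k at level 2, format "''a_' k").

(* porbits contains the singleton {x} for each fixed point x. *)
Definition ncycles (T : finType) (s : {perm T}) (k : nat) : nat :=
  #|[set c in porbits s | #|c| == k]|.

(* Cycle lengths never exceed #|T|, so all other factors would equal 1. *)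
Definition cycle_index (T : finType) (A : {group {perm T}}) : cpoly :=
  (#|A|%:R)^-1 *:
    \sum_(s in A) \prod_(1 <= k < #|T|.+1) 'a_k ^+ ncycles s k.

(* The ground set {1, ..., p} is represented by 'I_p = {0, ..., p-1}. *)
Definition rsubset (p r : nat) : finType := {X : {set 'I_p} | #|X| == r}.

Lemma rsubset_imset_proof (p r : nat) (s : 'S_p) (X : rsubset p r) :
  #|[set s i | i in val X]| == r.
Proof. by rewrite card_imset ?(valP X) //; exact: perm_inj. Qed.

Definition rsubset_imset (p r : nat) (s : 'S_p) (X : rsubset p r) :
    rsubset p r :=
  exist _ [set s i | i in val X] (rsubset_imset_proof s X).

Lemma rsubset_imset_inj (p r : nat) (s : 'S_p) :
  injective (@rsubset_imset p r s).
Proof.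
move=> X Y /(congr1 val) /= /imset_inj eqXY.
by apply/val_inj/eqXY; exact: perm_inj.
Qed.

Definition induced_perm (p r : nat) (s : 'S_p) : {perm rsubset p r} :=
  perm (@rsubset_imset_inj p r s).

Lemma induced_permM (p r : nat) :
  {in [set: 'S_p] &, {morph @induced_perm p r : s t / (s * t)%g}}.
Proof.
move=> s t _ _; apply/permP => X; rewrite permM !permE; apply: val_inj => /=.
by rewrite -imset_comp; apply: eq_imset => i; rewrite /= permM.
Qed.

Canonical induced_morphism (p r : nat) := Morphism (@induced_permM p r).

(* morphim is the plain image of [set: 'S_p], carrying its group structure. *)
Definition rgroup (p r : nat) : {group {perm rsubset p r}} :=
  (induced_morphism p r @* [set: 'S_p])%G.

(* Main.v *)
Require Import Defs.
From HB Require Import structures.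
From mathcomp Require Import all_boot all_order all_algebra all_fingroup.
From mathcomp.multinomials Require Import monalg.
Set Implicit Arguments.
Unset Strict Implicit.
Unset Printing Implicit Defensive.

Import GRing.Theory.
Local Open Scope ring_scope.

(* The k-cycles of a permutation are k times fewer than the points whose orbit
   has k elements, and these can be counted on any list of codes on which the
   permutation acts compatibly. Coding 3-subsets by their indicator words and
   S_6 by words of length 6 turns the sum over S_6 into a tally over 720 words,
   found by evaluation. Since S_p -> S_p^(r) is injective for 0 < r < p, the sum
   over the r-group is the sum over S_p. *)

(** * Cycle counts from periods *)

(** The least [m] with [1 <= m <= n] and [f^m x = x]; the default is [n.+1] if [x] does not recur
    within [n] steps. *)
Definition period {T : eqType} (f : T -> T) (n : nat) (x : T) : nat :=
  (index x (traject f (f x) n)).+1.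

(** Lengths paired with numbers of cycles. Zero counts are dropped, so that the resulting monomials
    have only the factors that are written in the theorem. *)
Definition cycle_type {T : eqType} (f : T -> T) (xs : seq T) :
    seq (nat * nat) :=
  let ps := [seq period f (size xs) x | x <- xs] in
  [seq b <- [seq (k, count_mem k ps %/ k)%N | k <- iota 1 (size xs)]
     | b.2 != 0%N].

Definition cycle_monomial (v : seq (nat * nat)) : cpoly :=
  \prod_(b <- v) 'a_b.1 ^+ b.2.

Lemma period_map (T U : eqType) (h : T -> U) (f : T -> T) (g : U -> U) n x :
  injective h -> {morph h : y / f y >-> g y} ->
  period g n (h x) = period f n x.
Proof.
move=> inj_h morph_h; rewrite /period -morph_h.
suff -> y : traject g (h y) n = map h (traject f y n) by rewrite index_map.
by elim: n y => //= n IHn y; rewrite -morph_h IHn.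
Qed.

Lemma card_porbit_period (T : finType) (s : {perm T}) (x : T) :
  #|porbit s x| = period s #|T| x.
Proof.
rewrite /period.
case def_n: #|porbit s x| (card_porbit_neq0 s x) (iter_porbit s x)
  (uniq_traject_porbit s x) (max_card (porbit s x)) => [//|n] _.
rewrite iterSr => s_x /= /andP[x_notin _] lt_nT; congr _.+1.
(* The first [n] entries of the trajectory avoid [x], and the next one is [s^(n+1) x = x]. *)
rewrite -(subnKC lt_nT) addSnnS trajectD index_cat (negPf x_notin) /= s_x eqxx.
by rewrite size_traject addn0.
Qed.

(** The orbits of size [k] partition the points lying in such orbits into blocks of [k] elements. *)
Lemma ncyclesE (T : finType) (s : {perm T}) (k : nat) : (0 < k)%N ->
  ncycles s k = (#|[set x | #|porbit s x| == k]| %/ k)%N.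
Proof.
move=> k_gt0; rewrite /ncycles; set P := [set c in _ | _].
rewrite (@card_uniform_partition _ k P) ?mulnK //.
  by move=> A; rewrite inE => /andP[_ /eqP].
apply/and3P; split.
- apply/eqP/setP => x; rewrite inE; apply/bigcupP/idP => [[A]|xk].
    rewrite inE => /andP[/imsetP[y _ ->] yk] /[dup] xy.
    by rewrite -eq_porbit_mem => /eqP->.
  by exists (porbit s x); rewrite ?porbit_id // inE xk imset_f.
- apply/trivIsetP => A B; rewrite !inE => /andP[/imsetP[x _ ->] _].
  case/andP=> /imsetP[y _ ->] _; apply: contraR => /pred0Pn[z] /andP[/=].
  by rewrite -!eq_porbit_mem => /eqP<- /eqP<-.
- rewrite inE; apply/negP => /andP[_]; rewrite cards0 => /eqP k0.
  by rewrite -k0 in k_gt0.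
Qed.

Lemma count_enum (T : finType) (a : pred T) : count a (enum T) = #|a|.
Proof. by rewrite -sum1_count big_enum_cond sum1_card. Qed.

Lemma cycle_monomial_porbits (T : finType) (U : eqType) (s : {perm T})
    (h : T -> U) (g : U -> U) (us : seq U) :
  injective h -> {morph h : x / s x >-> g x} ->
  perm_eq [seq h x | x <- enum T] us ->
  \prod_(1 <= k < #|T|.+1) 'a_k ^+ ncycles s k =
    cycle_monomial (cycle_type g us).
Proof.
move=> inj_h morph_h eq_us.
have szE : size us = #|T| by rewrite -(perm_size eq_us) size_map -cardE.
rewrite /cycle_monomial big_filter [RHS]big_mkcond big_map szE.
rewrite -[X in iota 1 X]/(#|T|.+1.-1) -subn1 -/(index_iota 1 #|T|.+1).
apply: eq_big_nat => k /andP[k_gt0 _] /=.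
(* A length dropped from [cycle_type] has exponent zero, so its factor is 1. *)
transitivity ('a_k ^+ (count_mem k [seq period g #|T| u | u <- us] %/ k));
  last by case: eqP => [->|].
rewrite ncyclesE //.
congr (_ ^+ (_ %/ _)); rewrite -(seq.permP (perm_map _ eq_us)).
rewrite 2!count_map cardsE count_enum; apply: eq_card => x.
by rewrite !inE (period_map _ _ inj_h morph_h) -card_porbit_period.
Qed.

(** * Faithfulness of the action on [r]-subsets *)

Lemma exists_rsubset_separating (p r : nat) (i j : 'I_p) :
  (0 < r < p)%N -> i != j ->
  exists X : rsubset p r, (i \in val X) && (j \notin val X).
Proof.
case/andP=> r_gt0 lt_rp ne_ij.
(* The separating set is [i] together with [r - 1] points other than [i] and [j]; these exist
   because [r - 1 <= p - 2]. *)
have: (0 < #|[set A : {set 'I_p} | A \subset ~: [set i; j] & #|A| == r.-1]|)%N.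
  rewrite cards_draws bin_gt0 cardsCs setCK cards2 ne_ij card_ord.
  by rewrite [(p - _)%N]subn2 -[r.-1]subn1 -[p.-2]subn1 leq_sub2r //
    -ltnS (ltn_predK lt_rp).
case/card_gt0P => A; rewrite inE => /andP[/subsetP sA /eqP cA].
have iA : i \notin A by apply/negP => /sA; rewrite !inE eqxx.
have jA : j \notin A by apply/negP => /sA; rewrite !inE eqxx orbT.
have cX : #|i |: A| == r by rewrite cardsU1 iA cA add1n prednK.
by exists (exist _ (i |: A) cX); rewrite /= !inE eqxx negb_or eq_sym ne_ij.
Qed.

Lemma induced_perm_inj (p r : nat) : (0 < r < p)%N ->
  injective (@induced_perm p r).
Proof.
move=> r_p s t eq_st; apply/permP => i; apply/eqP/negPn/negP => ne_st.
have [X /andP[siX tiX]] := exists_rsubset_separating r_p ne_st.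
(* Both [s] and [t] send [Y] to [X], which contains [s i] but not [t i]; so [Y] would both contain
   and omit [i]. *)
pose Y := ((induced_perm r s)^-1)%g X.
have imY u : induced_perm r s = induced_perm r u -> rsubset_imset u Y = X.
  move=> eq_su; rewrite -[LHS](permE (@rsubset_imset_inj p r u)).
  by rewrite -[perm _]eq_su permKV.
move: siX tiX; rewrite -{1}(imY s) // -(imY t) //= !mem_imset;
  try exact: perm_inj.
by move=> ->.
Qed.

Lemma cycle_index_rgroup (p r : nat) : (0 < r < p)%N ->
  cycle_index (rgroup p r) = (p`!%:R)^-1 *: \sum_(s : 'S_p)
    \prod_(1 <= k < #|rsubset p r|.+1) 'a_k ^+ ncycles (induced_perm r s) k.
Proof.
move=> r_p; have inj := @induced_perm_inj p r r_p.
have imE : rgroup p r = [set induced_perm r s | s in [set: 'S_p]] :> {set _}.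
  exact: morphimEdom.
rewrite /cycle_index imE (card_imset _ inj) cardsT card_Sn.
rewrite (big_imset _ (in2W inj)); congr (_ *: _).
by apply: eq_bigl => s; rewrite inE.
Qed.

(** * Words coding subsets and permutations *)

Definition indicator {p r : nat} (X : rsubset p r) : bitseq :=
  [seq i \in val X | i <- enum 'I_p].

(* The word of s lists the inverse of s, since s X contains i iff X contains
   s^-1 i. *)
Definition perm_word {p : nat} (s : 'S_p) : seq nat :=
  [seq val (s^-1%g i) | i <- enum 'I_p].

Definition word_act (w : seq nat) (m : bitseq) : bitseq :=
  [seq nth false m i | i <- w].

Lemma nth_indicator (p r : nat) (X : rsubset p r) (i : 'I_p) :
  nth false (indicator X) i = (i \in val X).
Proof. by rewrite (nth_map i) ?nth_ord_enum ?size_enum_ord. Qed.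

Lemma indicator_inj (p r : nat) : injective (@indicator p r).
Proof.
move=> X Y eqXY; apply/val_inj/setP => i.
by rewrite -!nth_indicator eqXY.
Qed.

Lemma indicator_induced (p r : nat) (s : 'S_p) (X : rsubset p r) :
  indicator (induced_perm r s X) = word_act (perm_word s) (indicator X).
Proof.
rewrite /word_act -map_comp; apply: eq_map => i /=.
rewrite nth_indicator permE /= -{1}(permKV s i) mem_imset //.
exact: perm_inj.
Qed.

Lemma perm_word_inj (p : nat) : injective (@perm_word p).
Proof.
move=> s t /eq_in_map eq_st; apply: invg_inj; apply/permP => i.
by apply/val_inj/eq_st; rewrite mem_enum.
Qed.

Lemma perm_words (p : nat) :
  perm_eq [seq perm_word s | s <- enum 'S_p] (permutations (iota 0 p)).
Proof.
have uniq_words : uniq [seq perm_word s | s <- enum 'S_p].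
  by rewrite map_inj_uniq ?enum_uniq //; apply: perm_word_inj.
apply: uniq_perm; rewrite ?permutations_uniq //.
(* A duplicate-free list contained in a list that is no longer has the same members; both lists have
   length [p!]. *)
apply: (uniq_min_size uniq_words _ _).2.
- move=> _ /mapP[s _ ->]; rewrite mem_permutations /perm_word -val_enum_ord.
  rewrite (map_comp val); apply/perm_map/uniq_perm => [||i].
  + by rewrite map_inj_uniq ?enum_uniq //; apply: perm_inj.
  + exact: enum_uniq.
  + rewrite mem_enum; apply/mapP; exists (s i); rewrite ?mem_enum //.
    by rewrite permK.
- by rewrite size_map size_permutations ?iota_uniq // size_iota -cardE card_Sn.
Qed.

Lemma perm_eq_bitseq (m n : bitseq) :
  size m = size n -> count id m = count id n -> perm_eq m n.
Proof.
move=> eq_size eq_ct; apply/allP => b _ /=; apply/eqP.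
have count_trueE (u : bitseq) : count_mem true u = count id u.
  by apply: eq_count => -[].
have count_falseE (u : bitseq) : count_mem false u = (size u - count id u)%N.
  by rewrite -(count_predC id) addKn; apply: eq_count => -[].
by case: b; rewrite ?count_trueE ?count_falseE ?eq_size eq_ct.
Qed.

Lemma size_indicator (p r : nat) (X : rsubset p r) : size (indicator X) = p.
Proof. by rewrite size_map size_enum_ord. Qed.

Lemma count_indicator (p r : nat) (X : rsubset p r) :
  count id (indicator X) = r.
Proof.
by rewrite count_map count_enum -[RHS](eqP (valP X)); apply: eq_card.
Qed.

(** Conversely to coding, a rearrangement of [r] trues and [p - r] falses is the indicator word of
    the set of its true positions. *)
Lemma perm_indicators (p r : nat) : (r <= p)%N ->
  perm_eq [seq indicator X | X <- enum (rsubset p r)]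
    (permutations (nseq r true ++ nseq (p - r) false)).
Proof.
move=> le_rp.
have sizeE : size (nseq r true ++ nseq (p - r) false) = p.
  by rewrite size_cat !size_nseq subnKC.
have countE : count id (nseq r true ++ nseq (p - r) false) = r.
  by rewrite count_cat !count_nseq mul1n mul0n addn0.
apply: uniq_perm => [||m].
- by rewrite map_inj_uniq ?enum_uniq //; apply: indicator_inj.
- exact: permutations_uniq.
rewrite mem_permutations; apply/mapP/idP => [[X _ ->]|eq_m].
  by apply: perm_eq_bitseq; rewrite ?size_indicator ?count_indicator.
have size_m : size m = p by rewrite (perm_size eq_m).
pose A := [set i : 'I_p | nth false m i].
have indE : [seq i \in A | i <- enum 'I_p] = m.
  apply: (@eq_from_nth _ false) => [|i];
    rewrite size_map size_enum_ord ?size_m //.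
  move=> lt_ip; rewrite (nth_map (Ordinal lt_ip)) ?size_enum_ord //.
  by rewrite inE nth_enum_ord.
have cA : #|A| == r.
  rewrite -[X in _ == X]countE -(seq.permP eq_m) -[in X in _ == X]indE.
  by rewrite count_map count_enum; apply/eqP/eq_card.
by exists (exist _ A cA); rewrite ?mem_enum // -[LHS]indE.
Qed.

Lemma cycle_index_rgroup_words (p r : nat) : (0 < r < p)%N ->
  cycle_index (rgroup p r) = (p`!%:R)^-1 *:
    \sum_(w <- permutations (iota 0 p))
      cycle_monomial
        (cycle_type (word_act w)
          (permutations (nseq r true ++ nseq (p - r) false))).
Proof.
move=> r_p; rewrite (cycle_index_rgroup r_p); congr (_ *: _).
apply: etrans (perm_big _ (perm_words p)).
rewrite big_map big_enum; apply: eq_bigr => s _.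
apply: (cycle_monomial_porbits (@indicator_inj p r)) => [X|].
  exact: indicator_induced.
by apply: perm_indicators; case/andP: r_p => _ /ltnW.
Qed.

(** * Grouping equal terms and evaluating for [S_6] *)

(** Starting from the first term leaves no unit element behind, and associativity moves the brackets
    to the left. *)
Lemma big_cons_foldl (I T : Type) (idx : T) (op : Monoid.law idx)
    (F : I -> T) (i : I) (s : seq I) :
  \big[op/idx]_(j <- i :: s) F j = foldl (fun x j => op x (F j)) (F i) s.
Proof.
rewrite big_cons; elim: s (F i) => [|j s IHs] x /=.
  by rewrite big_nil Monoid.mulm1.
by rewrite big_cons Monoid.mulmA; apply: IHs.
Qed.

(** The value of multiplicity one is singled out so that its term carries no coefficient; for [S_6]
    it is the cycle type of the identity. *)
Lemma sum_tally_map (I : Type) (T : eqType) (V : lmodType rat) (F : T -> V)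
    (f : I -> T) (s : seq I) (x : T) (bs : seq (T * nat)) :
  perm_eq (tally (map f s)) ((x, 1%N) :: bs) ->
  \sum_(i <- s) F (f i) = foldl (fun v b => v + b.2%:R *: F b.1) (F x) bs.
Proof.
move=> eq_bs; rewrite -(big_map f xpredT F).
rewrite -(perm_big _ (tallyK (map f s))) big_flatten big_map.
rewrite (perm_big _ eq_bs) big_cons_foldl /= big_seq1.
elim: bs (F x) {eq_bs} => //= b bs IHbs v; rewrite IHbs.
congr (foldl _ (_ + _) _).
by rewrite big_nseq -Monoid.iteropE scaler_nat.
Qed.

(** The order is that of the terms in the theorem. The eleven conjugacy classes of [S_6] give nine
    types: 80 joins the 3-cycles with the products of two disjoint 3-cycles, and 180 joins the
    4-cycles with the products of a disjoint 4-cycle and transposition. *)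
Definition cycle_types_S6_3 : seq (seq (nat * nat) * nat) :=
  [:: ([:: (1, 20)], 1); ([:: (1, 8); (2, 6)], 15); ([:: (1, 4); (2, 8)], 45);
      ([:: (1, 2); (3, 6)], 80); ([:: (1, 2); (3, 2); (6, 2)], 120);
      ([:: (2, 10)], 15); ([:: (2, 2); (4, 4)], 180);
      ([:: (2, 1); (6, 3)], 120); ([:: (5, 4)], 144)]%N.

Lemma tally_cycle_types_S6_3 :
  perm_eq
    (tally [seq cycle_type (word_act w)
             (permutations (nseq 3 true ++ nseq 3 false))
           | w <- permutations (iota 0 6)])
    cycle_types_S6_3.
Proof. by vm_compute. Qed.

Theorem mainTheorem2 :
  cycle_index (rgroup 6 3) =
    (6`!%:R)^-1 *:
      (  'a_1 ^+ 20
       + 15%:R *: ('a_1 ^+ 8 * 'a_2 ^+ 6)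
       + 45%:R *: ('a_1 ^+ 4 * 'a_2 ^+ 8)
       + 80%:R *: ('a_1 ^+ 2 * 'a_3 ^+ 6)
       + 120%:R *: ('a_1 ^+ 2 * 'a_3 ^+ 2 * 'a_6 ^+ 2)
       + 15%:R *: 'a_2 ^+ 10
       + 180%:R *: ('a_2 ^+ 2 * 'a_4 ^+ 4)
       + 120%:R *: ('a_2 * 'a_6 ^+ 3)
       + 144%:R *: 'a_5 ^+ 4 ).
Proof.
rewrite (@cycle_index_rgroup_words 6 3 isT); congr (_ *: _).
rewrite (sum_tally_map cycle_monomial tally_cycle_types_S6_3) /=.
rewrite /cycle_monomial !big_cons_foldl.
(* The left folds reproduce the bracketing of the right-hand side, so that only
   'a_2 ^+ 1 = 'a_2 is left, by conversion. *)
exact: erefl.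
Qed.
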